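(* Let $(X, \mu)$ be a probability space equipped with an ergodic measure-preserving action of $\mathbb{Z}^2$, and let $A \subseteq X$ be a measurable set such that for some $g_1, \ldots, g_n \in \mathbb{Z}^2$ the sets $g_1 A, \ldots, g_n A$ form a partition of $X$ (up to null sets). Then there exists a partition $(A_1, \ldots, A_m)$ of $A$ into measurable sets such that for each $i$ there is a non-zero $h_i \in \mathbb{Z}^2$ with $h_i A_i = A_i$ (up to null sets).
   Context: For $g \in \mathbb{Z}^2$ and $E \subseteq X$, $gE = \{g\cdot x : x \in E\}$ denotes the image of $E$ under the action of $g$. *)

(* Defs.v *)
From mathcomp Require Import all_boot all_order all_algebra.
From mathcomp Require Import all_classical all_reals all_analysis.

Set Implicit Arguments.
Unset Strict Implicit.
Unset Printing Implicit Defensive.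

Import GRing.Theory.

Local Open Scope classical_set_scope.
Local Open Scope ring_scope.

Notation Z2 := (int * int)%type.

Definition group_action (G : zmodType) (X : Type) (act : G -> X -> X) : Prop :=
  (forall x, act 0 x = x) /\
  (forall g h x, act (g + h) x = act g (act h x)).

Definition measure_preserving_action (R : realType) (d : measure_display)
    (X : measurableType d) (mu : probability X R) (G : zmodType)
    (act : G -> X -> X) : Prop :=
  [/\ group_action act,
      forall g, measurable_fun [set: X] (act g) &
      forall g E, measurable E -> mu (act g @^-1` E) = mu E].

Definition ergodic_action (R : realType) (d : measure_display)
    (X : measurableType d) (mu : probability X R) (G : zmodType)
    (act : G -> X -> X) : Prop :=
  forall E : set X, measurable E -> (forall g, act g @` E = E) ->
    mu E = 0%E \/ mu E = 1%E.

Definition ae_eq_set (R : realType) (d : measure_display)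
    (X : measurableType d) (mu : probability X R) (A B : set X) : Prop :=
  mu.-negligible (A `+` B).

(* Cells may be null here, whereas the library's [partition] excludes empty
   cells.  When the cells are translates of one set under a measure-preserving
   action on a probability space, they all have positive measure anyway. *)
Definition ae_partition (R : realType) (d : measure_display)
    (X : measurableType d) (mu : probability X R) (I : Type)
    (F : I -> set X) (A : set X) : Prop :=
  (forall i j, i <> j -> mu.-negligible (F i `&` F j)) /\
  ae_eq_set mu (\bigcup_i F i) A.

(* Main.v *)
(* The theorem is combinatorial on almost every orbit: for x outside a null set,
   the return set a = {v in Z^2 : v x in A} tiles Z^2 by finitely many shifts f_i,
   and it suffices to find N <> 0 and a finite set U of nonzero vectors, depending
   only on f, such that a restricted to N Z^2 is u N-periodic for some u in U;
   the cells are then cut out by the first such u.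

   Working modulo primes, the tiling dilates to the shifts r f_i for all r = 1 mod n!.
   With f_0 = 0, averaging over r with a Banach limit gives a + sum_{i <> 0} phi_i = 1
   with phi_i >= 0 invariant under n! f_i.  Let psi_i be the sum of the phi_j with f_j
   parallel to f_i.  Where psi_i > 0 we have a = 0, so averaging the identity along
   the direction f_i shows that psi_i takes only two values 0, b_i on N Z^2.
   If some b_i = 1, then intersecting a line in direction f_i with a line in direction
   f_j shows that all the other phi_j vanish on N Z^2, so a is periodic along f_i.
   Otherwise every b_i lies in [0, 1); repeated differencing of the identity
   along the remaining directions shows that iterated differences of psi_i are
   integers, so psi_i is determined along a line by a window of bounded length,
   hence is periodic with a period bounded in terms of n alone. *)
Require Import Defs.
From mathcomp Require Import all_boot all_order all_algebra.
From mathcomp Require Import all_classical all_reals all_analysis.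
From mathcomp Require Import zify ring lra.

Set Implicit Arguments.
Unset Strict Implicit.
Unset Printing Implicit Defensive.

Import Order.TTheory GRing.Theory Num.Theory.
Import numFieldNormedType.Exports.

Local Open Scope classical_set_scope.
Local Open Scope ring_scope.

(** * Dilation of tilings *)

(** Action on functions of the group-ring element whose terms are the entries of [s]; iterates are
    its powers. *)
Definition shift_sum (G : zmodType) (K : nmodType) (s : seq G) (u : G -> K) (v : G) :=
  \sum_(h <- s) u (v + h).

(** Binomial theorem for two commuting operators: translation by [f] and [shift_sum s]. *)
Lemma iter_shift_sum_cons (G : zmodType) (K : nmodType) (f : G) (s : seq G) (u : G -> K) m v :
  iter m (shift_sum (f :: s)) u v =
  \sum_(k < m.+1) iter (m - k) (shift_sum s) u (v + f *+ k) *+ 'C(m, k).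
Proof.
elim: m v => [|m IHm] v.
  by rewrite big_ord1 /= addr0 bin0.
rewrite iterS {1}/shift_sum big_cons IHm.
under eq_bigr => h _ do rewrite IHm.
rewrite exchange_big /=.
have -> : \sum_(k < m.+1) \sum_(h <- s) iter (m - k) (shift_sum s) u (v + h + f *+ k) *+ 'C(m, k) =
          \sum_(k < m.+2) iter (m.+1 - k) (shift_sum s) u (v + f *+ k) *+ 'C(m, k).
  (* The added term [k = m + 1] has coefficient zero; it aligns the two ranges for Pascal's rule. *)
  rewrite [RHS]big_ord_recr /= [in 'C(m, m.+1)]bin_small // mulr0n addr0.
  apply: eq_bigr => k _; rewrite subSn -1?ltnS // iterS -sumrMnl.
  by apply: eq_bigr => h _; rewrite addrAC.
rewrite [X in _ + X]big_ord_recl [RHS]big_ord_recl /= !mulr0n !addr0 !bin0 !mulr1n addrCA.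
congr (_ + _); rewrite -big_split /=; apply: eq_bigr => k _.
by rewrite subSS binS mulrnDr addrC -addrA -mulrS.
Qed.

(** Frobenius: the inner binomial coefficients are divisible by [p], so the [p]-th power of a sum of
    translations is the sum of their [p]-th powers. *)
Lemma iter_shift_sum_pchar (G : zmodType) (K : nzRingType) p (s : seq G) (u : G -> K) v :
  p \in [pchar K] ->
  iter p (shift_sum s) u v = \sum_(h <- s) u (v + h *+ p).
Proof.
move=> pK; have pp := pcharf_prime pK; have p0 := prime_gt0 pp.
elim: s v => [|f s IHs] v.
  by rewrite -(prednK p0) iterS /shift_sum !big_nil.
rewrite iter_shift_sum_cons big_ord_recr /= subnn /= binn mulr1n big_cons addrC; congr (_ + _).
rewrite (bigD1 (Ordinal p0)) //= mulr0n addr0 bin0 mulr1n subn0 IHs.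
rewrite [X in _ + X]big1 ?addr0 // => k k0.
rewrite -mulr_natr.
suff /eqP -> : ('C(p, k))%:R == 0 :> K by rewrite mulr0.
rewrite -(dvdn_pcharf pK) prime_dvd_bin // ltn_ord andbT lt0n //.
Qed.

Definition exact_tiling (G : zmodType) (I : finType) (f : I -> G) (a : G -> bool) :=
  forall v, (\sum_i a (v + f i)%R = 1)%N.

Lemma iter_shift_sum_const (G : zmodType) (K : nzRingType) (s : seq G) (w : G -> K) m v :
  (forall v, w v = 1) -> iter m (shift_sum s) w v = (size s)%:R ^+ m.
Proof.
move=> w1; elim: m v => [|m IHm] v /=; first by rewrite w1.
rewrite /shift_sum (eq_bigr _ (fun h _ => IHm (v + h))) big_const_seq.
by rewrite count_predT iter_addr_0 exprS mulr_natl.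
Qed.

(** Modulo [p], the [p]-th power of the tiling operator sends [a] to the dilated count by Frobenius,
    and to [#|I| ^ (p - 1) = 1] by Fermat. The count is at most [#|I| < p], hence equal to 1. *)
Lemma exact_tiling_dilate_prime (G : zmodType) (I : finType) (f : I -> G) a p :
  prime p -> (#|I| < p)%N -> exact_tiling f a ->
  exact_tiling (fun i => f i *+ p) a.
Proof.
move=> pp Ip fa v.
have pF := pchar_Fp pp; have p1 := prime_gt1 pp.
set s := [seq f i | i <- enum I].
have ssz : size s = #|I| by rewrite size_map cardE.
pose u v : 'F_p := (a v)%:R.
have u1 w : shift_sum s u w = 1.
  by rewrite /shift_sum big_map big_enum /= /u -natr_sum fa.
have I0 : (0 < #|I|)%N.
  rewrite lt0n; apply/negP => /eqP /card0_eq I0; have := fa 0.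
  by rewrite big_pred0.
have nz : (#|I|)%:R != 0 :> 'F_p.
  by rewrite -(dvdn_pcharf pF) gtnNdvd.
have : iter p.-1.+1 (shift_sum s) u v = 1.
  rewrite iterSr iter_shift_sum_const // ssz.
  apply: (mulfI nz); rewrite -exprS prednK ?prime_gt0 // mulr1.
  exact: (pFrobenius_aut_nat pF).
rewrite (prednK (prime_gt0 pp)).
rewrite iter_shift_sum_pchar // big_map big_enum /= /u -natr_sum => /(congr1 val) /=.
rewrite (val_Fp_nat pp) modn_small.
  by rewrite (Fp_cast pp) modn_small.
apply: leq_ltn_trans Ip; rewrite -sum1_card; apply: leq_sum => i _; exact: leq_b1.
Qed.

(** Coprimality makes every prime factor of [r] exceed [#|I|], and prime dilations compose. *)
Lemma exact_tiling_dilate (G : zmodType) (I : finType) (f : I -> G) a r :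
  (0 < r)%N -> coprime r #|I| `! -> exact_tiling f a ->
  exact_tiling (fun i => f i *+ r) a.
Proof.
elim/ltn_ind: r => r IHr r0 cr fa.
have [r1|] := leqP r 1.
  have -> : r = 1%N by lia.
  exact: fa.
move=> r1; have pp := pdiv_prime r1; have pr := pdiv_dvd r.
move: (pdiv r) pp pr => p pp /dvdnP[q rE]; subst r.
move: r0; rewrite muln_gt0 => /andP[q0 p0].
move: cr; rewrite coprimeMl => /andP[cq cp].
have Ip : (#|I| < p)%N.
  rewrite ltnNge; apply/negP => pI.
  have : (p %| #|I| `!)%N by rewrite dvdn_fact // p0.
  by apply/negP; rewrite -prime_coprime.
have := exact_tiling_dilate_prime pp Ip (IHr q _ q0 cq fa).
move=> H v; rewrite -[RHS](H _ v).
  by apply: eq_bigr => i _; rewrite mulrnA.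
by rewrite ltn_Pmulr // prime_gt1.
Qed.

(** * Banach limits *)

(** Compactness of the interval from [- M] to [M] gives a cluster point, to which an ultrafilter
    converges. *)
Lemma ultra_bounded_cvg (R : realType) (F : set_system nat) (u : nat -> R) (M : R) :
  UltraFilter F -> (forall n, `|u n| <= M) -> cvg (u @ F).
Proof.
move=> UF uM.
have [|x [_ xcl]] := @segment_compact R (- M) M (u @ F) _.
  by apply: (@filterE _ F) => n /=; rewrite in_itv /= -ler_norml.
apply/cvg_ex; exists x => B Bx /=.
have [//|FB] := in_ultra_setVsetC (u @^-1` B) UF.
by have [y []] := xcl (~` B) B FB Bx.
Qed.

Definition bounded_seq (R : realType) (u : nat -> R) := exists M, forall n, `|u n| <= M.

Definition is_banach_limit (R : realType) (LIM : (nat -> R) -> R) :=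
  [/\ forall u v, bounded_seq u -> bounded_seq v -> LIM (u \+ v) = LIM u + LIM v,
      forall u, bounded_seq u -> (forall n, 0 <= u n) -> 0 <= LIM u,
      forall c, LIM (cst c) = c &
      forall u, bounded_seq u -> LIM (u \o S) = LIM u].

(** Take the limit of the Cesaro means along a free ultrafilter; a shift changes these means by a
    quantity tending to zero. *)
Lemma exists_banach_limit (R : realType) :
  exists LIM : (nat -> R) -> R, is_banach_limit LIM.
Proof.
have [F [UF sF]] := ultraFilterLemma (@eventually_filter).
pose A (u : nat -> R) N := (\sum_(k < N.+1) u k) / N.+1%:R.
have Ab u M : (forall n, `|u n| <= M) -> forall n, `|A u n| <= M.
  move=> uM n; rewrite /A normrM normfV (@ger0_norm _ n.+1%:R) // ler_pdivrMr //.
  apply: (le_trans (ler_norm_sum _ _ _)).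
  apply: (@le_trans _ _ (\sum_(k < n.+1) M)); first exact: ler_sum.
  by rewrite sumr_const card_ord mulr_natr.
exists (fun u => lim (A u @ F)); split.
- move=> u v [M uM] [M' vM].
  have cu : cvg (A u @ F) by exact: ultra_bounded_cvg (Ab _ _ uM).
  have cv : cvg (A v @ F) by exact: ultra_bounded_cvg (Ab _ _ vM).
  have -> : A (u \+ v) = A u \+ A v.
    by apply/funext => N; rewrite /A /= big_split mulrDl.
  exact: limD.
- move=> u [M uM] u0.
  have cu : cvg (A u @ F) by exact: ultra_bounded_cvg (Ab _ _ uM).
  apply: limr_ge => //; apply: nearW => N; rewrite /A divr_ge0 //.
  exact: sumr_ge0.
- move=> c; apply/cvg_lim => //.
  have -> : A (cst c) = cst c.
    apply/funext => N; rewrite /A /= sumr_const card_ord -[X in X / _]mulr_natr mulfK //.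
  exact: cvg_cst.
- move=> u [M uM].
  have cu : cvg (A u @ F) by exact: ultra_bounded_cvg (Ab _ _ uM).
  apply/cvg_lim => //.
  have -> : A (u \o S) = A u \+ (fun N => (u N.+1 - u 0) / N.+1%:R).
    apply/funext => N; rewrite /A /= -mulrDl; congr (_ / _).
    rewrite addrA [in RHS]big_ord_recl /=.
    rewrite [in LHS]big_ord_recr /= (eq_bigr (fun i : 'I_N => u (bump 0 i))) //.
    by ring.
  rewrite -[X in _ --> X]addr0; apply: cvgD; first exact: cu.
  suff : (fun N => (u N.+1 - u 0) / N.+1%:R) @ \oo --> (0 : R).
    by apply: cvg_trans => B; apply: sF.
  have M0 : 0 <= M by apply: le_trans (uM 0%N).
  apply/norm_cvg0P.
  apply: (@squeeze_cvgr _ _ _ _ (cst 0) (fun N => (2 * M) * harmonic N)).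
  + apply: nearW => N /=; rewrite normr_ge0 /= normrM normfV.
    rewrite (@ger0_norm _ N.+1%:R) // ler_wpM2r // ?invr_ge0 //.
    apply: (le_trans (ler_normB _ _)); have := uM N.+1; have := uM 0%N; lra.
  + exact: cvg_cst.
  + by rewrite -[X in _ --> X](mulr0 (2 * M)); apply: cvgM; [exact: cvg_cst|exact: cvg_harmonic].
Qed.

Lemma banach_limit_sum (R : realType) (LIM : (nat -> R) -> R) (I : finType) (P : pred I)
    (u : I -> nat -> R) :
  is_banach_limit LIM -> (forall i, bounded_seq (u i)) ->
  LIM (fun n => \sum_(i | P i) u i n) = \sum_(i | P i) LIM (u i).
Proof.
move=> [LD _ Lc _] ub.
(* Additivity is only given for bounded sequences, so boundedness is carried through the
   induction. *)
pose K (f : nat -> R) y := bounded_seq f /\ LIM f = y.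
suff [] : K (fun n => \sum_(i | P i) u i n) (\sum_(i | P i) LIM (u i)) by [].
have -> : (fun n => \sum_(i | P i) u i n) = \big[(fun f g => f \+ g)/cst 0]_(i | P i) u i.
  apply/funext => n.
  by elim/big_rec2 : _ => [|i x f _ ->].
elim/big_rec2 : _ => [|i x f _ [[M fM] <-]].
  by split; [exists 0 => n; rewrite normr0|exact: Lc].
have [M' uM] := ub i; split; last by apply: LD; [exists M'|exists M].
by exists (M' + M) => n; rewrite /= (le_trans (ler_normD _ _)) // lerD.
Qed.

(** * Iterated differences *)

Lemma invariant_mulrz (G : zmodType) (T : Type) (F : G -> T) (h : G) :
  (forall v, F (v + h) = F v) -> forall z v, F (v + h *~ z) = F v.
Proof.
move=> Fh; have Fn (n : nat) v : F (v + h *+ n) = F v.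
  by elim: n v => [|n IHn] v; rewrite ?mulr0n ?addr0 // mulrSr addrA Fh IHn.
by case=> n v; [exact: Fn|rewrite NegzE mulrNz -[in RHS](subrK (h *+ n.+1) v) Fn].
Qed.

Lemma banach_limit_shiftz (R : realType) (LIM : (nat -> R) -> R) (u : int -> R) (M : R) (z : int) :
  is_banach_limit LIM -> (forall l, `|u l| <= M) ->
  LIM (fun n => u (n%:Z + z)) = LIM (fun n => u n%:Z).
Proof.
move=> [_ _ _ LS] uM.
have F1 (l : int) : LIM (fun n => u (n%:Z + (l + 1))) = LIM (fun n => u (n%:Z + l)).
  rewrite -[RHS]LS; last by exists M.
  by congr LIM; apply/funext => n /=; congr u; lia.
have := invariant_mulrz (F := fun l => LIM (fun n => u (n%:Z + l))) F1 z 0.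
by rewrite intz add0r => ->; congr LIM; apply/funext => n; rewrite addr0.
Qed.

Definition diff (G V : zmodType) (t : G) (F : G -> V) (v : G) := F (v + t) - F v.

Lemma diffC (G V : zmodType) (s t : G) (F : G -> V) : diff s (diff t F) = diff t (diff s F).
Proof.
by apply/funext => v; rewrite /diff [v + t + s]addrAC !opprD addrACA.
Qed.

Lemma iter_diffC (G V : zmodType) (s t : G) r (F : G -> V) :
  iter r (diff s) (diff t F) = diff t (iter r (diff s) F).
Proof. by elim: r => //= r ->; rewrite diffC. Qed.

Definition diffs (G V : zmodType) (ts : seq G) (F : G -> V) := foldr (@diff G V) F ts.

Lemma diffs_sum (G V : zmodType) (ts : seq G) (I : finType) (P : pred I) (F : I -> G -> V) v :
  diffs ts (fun v => \sum_(i | P i) F i v) v = \sum_(i | P i) diffs ts (F i) v.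
Proof. by elim: ts v => [|t ts IHts] v //=; rewrite /diff !IHts sumrB. Qed.

Lemma diffs_int (G : zmodType) (R : archiNumDomainType) (ts : seq G) (F : G -> R) :
  (forall v, F v \is a Num.int) -> forall v, diffs ts F v \is a Num.int.
Proof. by move=> Fi; elim: ts => [|t ts IHts] v //=; rewrite /diff rpredB. Qed.

Lemma diffs_invariant (G V : zmodType) (ts : seq G) (F : G -> V) h :
  (forall v, F (v + h) = F v) -> forall v, diffs ts F (v + h) = diffs ts F v.
Proof. by move=> Fh; elim: ts => [|t ts IHts] v //=; rewrite /diff addrAC !IHts. Qed.

Lemma diffs_eq0 (G V : zmodType) (ts : seq G) (F : G -> V) t :
  t \in ts -> (forall v, F (v + t) = F v) -> forall v, diffs ts F v = 0.
Proof.
move=> + Ft; elim: ts => [//|s ts IHts]; rewrite in_cons => /orP[/eqP <-|tts] v /=; rewrite /diff.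
  by rewrite diffs_invariant // subrr.
by rewrite !IHts // subrr.
Qed.

(** Steps that agree modulo a period [h] of [F] act alike on [F]. *)
Lemma diffs_iter (G V : zmodType) (ts : seq G) (F : G -> V) h t :
  (forall v, F (v + h) = F v) -> (forall s, s \in ts -> exists z, s = t + h *~ z) ->
  forall v, diffs ts F v = iter (size ts) (diff t) F v.
Proof.
move=> Fh; elim: ts => [//|s ts IHts] tsP v /=.
rewrite /diff -!IHts => [|s' s'ts|s' s'ts]; try by apply: tsP; rewrite in_cons s'ts orbT.
have [z ->] := tsP s (mem_head _ _).
by rewrite addrA (invariant_mulrz (diffs_invariant _ Fh)).
Qed.

Lemma iter_diff_line (G V : zmodType) (F : G -> V) x t r (l : int) :
  iter r (diff t) F (x + t *~ l) = iter r (diff 1) (fun l => F (x + t *~ l)) l.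
Proof.
by elim: r l => [|r IHr] l //=; rewrite /diff -!IHr mulrzDr mulr1z addrA.
Qed.

(** The [r]-th difference is a signed binomial sum of the values at [l, ..., l + r]; only the last
    survives, with coefficient 1. *)
Lemma iter_diff_first (V : zmodType) r (d : int -> V) (l : int) :
  (forall k, (k < r)%N -> d (l + k%:Z) = 0) -> iter r (diff 1) d l = d (l + r%:Z).
Proof.
elim: r d => [|r IHr] d d0; first by rewrite /= addr0.
rewrite iterSr IHr => [|k kr]; rewrite /diff.
  by rewrite d0 // subr0; congr d; lia.
by rewrite d0 1?ltnW // subr0 -(d0 k.+1) //; congr d; lia.
Qed.

(** Here only the value at [l] survives in the binomial sum, with coefficient 1 or -1. *)
Lemma iter_diff_last (R : numDomainType) r (d : int -> R) (l : int) :
  (forall k, (k < r)%N -> d (l + 1 + k%:Z) = 0) -> `|iter r (diff 1) d l| = `|d l|.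
Proof.
elim: r d => [//|r IHr] d d0.
rewrite iterSr IHr => [|k kr]; rewrite /diff.
  by rewrite -[l + 1]addr0 d0 // sub0r normrN.
rewrite (d0 k) 1?ltnW // subr0 -(d0 k.+1) //; congr d; lia.
Qed.

Lemma int_norm_lt1 (R : archiRealFieldType) (x : R) : x \is a Num.int -> `|x| < 1 -> x = 0.
Proof.
move=> /intrP[z ->]; rewrite -intr_norm -[1]/(1%:~R) ltr_int => z1.
by have -> : z = 0 by lia.
Qed.

(** At either end of a window of zeros, the [r]-th difference is up to sign the next value of [d]:
    an integer of absolute value below 1, so zero. The window thus slides both ways. *)
Lemma eq0_of_window (R : archiRealFieldType) r (d : int -> R) (l0 : int) :
  (forall l, `|d l| < 1) -> (forall l, iter r (diff 1) d l \is a Num.int) ->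
  (forall k, (k < r)%N -> d (l0 + k%:Z) = 0) -> forall l, d l = 0.
Proof.
move=> d1 dint d0.
have fwd (m k : nat) : (k < r)%N -> d (l0 + m%:Z + k%:Z) = 0.
  elim: m k => [|m IHm] k kr; first by rewrite addr0 d0.
  have [kr'|kr'] := ltnP k.+1 r.
    by rewrite -(IHm k.+1) //; congr d; lia.
  have -> : l0 + m.+1%:Z + k%:Z = l0 + m%:Z + r%:Z by lia.
  by rewrite -iter_diff_first //; apply: int_norm_lt1 => //; rewrite iter_diff_first.
have bwd (m k : nat) : (k < r)%N -> d (l0 - m%:Z + k%:Z) = 0.
  elim: m k => [k kr|m IHm [|k] kr]; first by rewrite subr0 d0.
    have H k : (k < r)%N -> d (l0 - m.+1%:Z + 1 + k%:Z) = 0.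
      by move=> kr'; rewrite -(IHm k) //; congr d; lia.
    rewrite addr0; apply/eqP; rewrite -normr_eq0 -(iter_diff_last H) normr_eq0; apply/eqP.
    by apply: int_norm_lt1 => //; rewrite (iter_diff_last H).
  by rewrite -(IHm k) 1?ltnW //; congr d; lia.
move=> l; have [r0|r0] := posnP r.
  by apply: int_norm_lt1 => //; have := dint l; rewrite r0.
have [l0l|ll0] := lerP l0 l.
  by rewrite -(fwd `|l - l0|%N 0%N) //; congr d; lia.
by rewrite -(bwd `|l0 - l|%N 0%N) //; congr d; lia.
Qed.

(* Pigeonhole: [s] is recovered from any window of length [r], and there are only [2 ^ r] windows. *)
Lemma two_valued_periodic (R : archiRealFieldType) r (s : int -> R) (b : R) :
  `|b| < 1 -> (forall l, s l = 0 \/ s l = b) ->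
  (forall l, iter r (diff 1) s l \is a Num.int) ->
  exists P, [/\ (0 < P)%N, (P <= 2 ^ r)%N & forall l, s (l + P%:Z) = s l].
Proof.
move=> b1 sb sint.
pose W (m : 'I_(2 ^ r).+1) := [ffun k : 'I_r => s (m%:Z + k%:Z) == 0].
have /injectivePn[m [m' mm' WW]] : ~~ injectiveb W.
  apply/negP => /injectiveP/leq_card.
  by rewrite card_ord card_ffun card_bool card_ord ltnn.
wlog mlt : m m' mm' WW / (m < m')%N => [hwlog|].
  have [|m'm|/val_inj] := ltngtP m m'; first exact: hwlog.
    by apply: (hwlog m' m) => //; rewrite eq_sym.
  by move=> E; rewrite E eqxx in mm'.
exists (m' - m)%N; split.
- by rewrite subn_gt0.
- by rewrite leq_subLR (leq_trans (ltnSE (ltn_ord m'))) // leq_addl.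
move=> l; apply/eqP; rewrite -subr_eq0; apply/eqP; move: l.
(* The difference of [s] and its translate takes only the values 0, [b] and [- b], and vanishes on
   the repeated window. *)
apply: (@eq0_of_window _ r (diff (m' - m)%N%:Z s) m%:Z) => [l|l|k kr].
- by rewrite /diff; have [->|->] := sb (l + (m' - m)%N%:Z); have [->|->] := sb l;
    rewrite ?subrr ?subr0 ?sub0r ?normrN ?normr0.
- by rewrite iter_diffC /diff rpredB.
- rewrite /diff; have -> : m%:Z + k%:Z + (m' - m)%N%:Z = m'%:Z + k%:Z by lia.
  have /ffunP/(_ (Ordinal kr)) := WW; rewrite !ffunE /=.
  have [->|->] := sb (m%:Z + k%:Z); have [->|->] := sb (m'%:Z + k%:Z); rewrite ?subrr // eqxx.
    by move=> /esym/eqP ->; rewrite subrr.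
  by move=> /eqP ->; rewrite subrr.
Qed.

(** * Decompositions into functions invariant along a direction *)

Definition class_sum (G : zmodType) (R : nmodType) (I : finType) (par : rel I)
  (phi : I -> G -> R) (i : I) (v : G) := \sum_(j | par i j) phi j v.

(** [par] stands for parallelism of directions. Invariance of [phi j] is asked along every [h i]
    with [par i j], so that the whole class sum of [i] is invariant under [h i]. *)
Definition invariant_decomposition (G : zmodType) (R : numDomainType) (I : finType)
    (par : rel I) (h : I -> G) (a : G -> bool) (phi : I -> G -> R) :=
  [/\ forall i v, 0 <= phi i v,
      forall i j v, par i j -> phi j (v + h i) = phi j v &
      forall v, (a v)%:R + \sum_i phi i v = 1].

Definition transversal_lattice (G : zmodType) (I : finType) (par : rel I) (h : I -> G) (N : int) :=
  forall i j, ~~ par i j -> forall w, exists z : int * int, w *~ N = h i *~ z.1 + h j *~ z.2.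

Section Decomposition.
Context (G : zmodType) (R : realType) (I : finType) (par : rel I) (h : I -> G) (N : int).
Context (a : G -> bool) (phi : I -> G -> R).
Hypothesis par_refl : reflexive par.
Hypothesis dec : invariant_decomposition par h a phi.
Hypothesis lat : transversal_lattice par h N.
Local Notation psi := (class_sum par phi).

Lemma class_sum_split i v :
  (a v)%:R + (psi i v + \sum_(j | ~~ par i j) phi j v) = 1.
Proof. by have [_ _ phi1] := dec; rewrite -[RHS](phi1 v) [in RHS](bigID (par i)) /=.
Qed.

Lemma class_sum_ge0 i v : 0 <= psi i v.
Proof. by have [phi0 _ _] := dec; apply: sumr_ge0. Qed.

Lemma cosum_ge0 i v : 0 <= \sum_(j | ~~ par i j) phi j v.
Proof. by have [phi0 _ _] := dec; apply: sumr_ge0. Qed.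

Lemma phi_le_class_sum i v : phi i v <= psi i v.
Proof.
have [phi0 _ _] := dec.
by rewrite /class_sum (bigD1 i) ?par_refl //= lerDl sumr_ge0.
Qed.

Lemma class_sum_invariant i z v : psi i (v + h i *~ z) = psi i v.
Proof.
have [_ phih _] := dec; apply: eq_bigr => j ij.
exact: (invariant_mulrz (fun v => phih i j v ij)).
Qed.

Lemma phi_invariant i z v : phi i (v + h i *~ z) = phi i v.
Proof. have [_ phih _] := dec; exact: (invariant_mulrz (fun v => phih i i v (par_refl i))). Qed.

Lemma phi_le1 i v : phi i v <= 1.
Proof.
apply: le_trans (phi_le_class_sum i v) _.
have := class_sum_split i v; have := cosum_ge0 i v.
by case: (a v) => /=; lra.
Qed.

(** [a v = 1] would force the nonnegative [psi i v] to vanish. *)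
Lemma a_class_sum_gt0 i v : 0 < psi i v -> psi i v + \sum_(j | ~~ par i j) phi j v = 1.
Proof.
move=> p0; have := class_sum_split i v; have := cosum_ge0 i v.
by case: (a v) => /=; lra.
Qed.

(* Averaging [a + sum phi = 1] along the direction [h i], on which [psi i] is
   constant, the remaining terms have averages that are constant on the lattice. *)
Lemma class_sum_const i w w' :
  0 < psi i (w *~ N) -> 0 < psi i (w' *~ N) -> psi i (w *~ N) = psi i (w' *~ N).
Proof.
have [phi0 _ _] := dec.
have [LIM LIMP] := exists_banach_limit R.
have [LD _ Lc _] := LIMP.
have phib j (x t : G) (l : int) : `|phi j (x + t *~ l)| <= 1.
  by rewrite ger0_norm ?phi_le1.
pose co x := \sum_(j | ~~ par i j) LIM (fun n => phi j (x + h i *~ n%:Z)).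
have H x : 0 < psi i x -> psi i x + co x = 1.
  move=> px; rewrite -[RHS]Lc -(Lc (psi i x)) /co -banach_limit_sum //; last first.
    by move=> j; exists 1 => n.
  rewrite -LD; last 2 first.
  - by exists `|psi i x|.
  - exists 1 => n; rewrite ger0_norm ?cosum_ge0 //.
    rewrite -(@a_class_sum_gt0 i (x + h i *~ n%:Z)) ?class_sum_invariant // lerDr class_sum_ge0 //.
  congr LIM; apply/funext => n /=; rewrite -(class_sum_invariant i n%:Z).
  by rewrite a_class_sum_gt0 // class_sum_invariant.
move=> px py; apply: (addIr (co (w *~ N))); rewrite H //.
suff -> : co (w *~ N) = co (w' *~ N) by rewrite H.
apply: eq_bigr => j ij.
(* The [h j] part of the displacement is absorbed by the invariance of [phi j], the [h i] part by
   the shift invariance of [LIM]. *)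
have [[z1 z2] /= zE] := lat ij (w - w').
rewrite -(banach_limit_shiftz (u := fun l => phi j (w' *~ N + h i *~ l)) z1 LIMP (phib _ _ _)).
congr LIM; apply/funext => n.
have -> : w *~ N = w' *~ N + (h i *~ z1 + h j *~ z2).
  by rewrite -zE mulrzBl addrC subrK.
by rewrite !addrA addrAC -(addrA _ (h i *~ z1)) -mulrzDr addrAC phi_invariant [z1 + _]addrC.
Qed.

(** The line through [w N] along [h i] meets the line through [w' N] along [h j]. At the meeting
    point [psi i] is still at least 1, which forces [phi j] to be 0 there, and [phi j] is constant
    along the second line. *)
Lemma phi_eq0_of_class_sum_ge1 i w :
  1 <= psi i (w *~ N) -> forall j w', ~~ par i j -> phi j (w' *~ N) = 0.
Proof.
have [phi0 _ _] := dec.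
move=> p1 j w' ij; have [[z1 z2] /= zE] := lat ij (w' - w).
have zE' : w' *~ N + h j *~ (- z2) = w *~ N + h i *~ z1.
  by rewrite mulrNz; apply/eqP; rewrite subr_eq -addrA -zE mulrzBl addrC subrK.
rewrite -(phi_invariant j (- z2)) zE'.
have p1' : 1 <= psi i (w *~ N + h i *~ z1) by rewrite class_sum_invariant.
have := class_sum_split i (w *~ N + h i *~ z1).
rewrite (bigD1 j) //=.
have := phi0 j (w *~ N + h i *~ z1).
have : 0 <= \sum_(k | ~~ par i k && (k != j)) phi k (w *~ N + h i *~ z1) by apply: sumr_ge0.
by case: (a _) => /=; lra.
Qed.

(** For [j] not parallel to [i], write [e N] as a multiple of [h i] plus a multiple of [h j].
    Differencing by the latter kills [phi j] and acts on [psi i] as differencing by [e N]. Doing so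
    for all such [j] turns the integer-valued [1 - a] into an iterated difference of [psi i]. *)
Lemma diff_class_sum_int i e :
  exists2 r, (r <= #|I|)%N &
    forall v, iter r (diff (e *~ N)) (psi i) v \is a Num.int.
Proof.
have [phi0 _ phi1] := dec.
have /choice[z zP] : forall j, exists z : int * int,
    ~~ par i j -> e *~ N = h i *~ z.1 + h j *~ z.2.
  move=> j; have [_|ij] := boolP (par i j); first by exists (0, 0).
  by have [z zE] := lat ij e; exists z.
pose ts := [seq h j *~ (z j).2 | j <- enum [pred j | ~~ par i j]].
exists (size ts); first by rewrite size_map -cardE max_card.
move=> v; rewrite -(@diffs_iter _ _ ts (psi i) (h i)); last 2 first.
- by move=> u; rewrite -[in LHS](mulr1z (h i)) class_sum_invariant.
- move=> _ /mapP[j + ->]; rewrite mem_enum => /zP ->.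
  by exists (- (z j).1); rewrite mulrNz addrC addKr.
have -> : diffs ts (psi i) v = diffs ts (fun v => \sum_j phi j v) v.
  rewrite diffs_sum diffs_sum [RHS](bigID (par i)) /= [X in _ = _ + X]big1 ?addr0 // => j ij.
  apply: (@diffs_eq0 _ _ _ _ (h j *~ (z j).2)); last by move=> u; exact: phi_invariant.
  by apply: map_f; rewrite mem_enum.
apply: diffs_int => u.
have -> : \sum_j phi j u = 1 - (a u)%:R by apply/esym/eqP; rewrite subr_eq addrC phi1.
by apply: rpredB; [exact: rpred1|exact: natr_int].
Qed.

(** Since [a] is read off from the zeros of the class sums, a common period of these is a period of
    [a]. *)
Lemma a_class_sum v : a v = [forall i, psi i v == 0].
Proof.
have [phi0 _ phi1] := dec.
apply/idP/forallP => [av i|psi0].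
  have := class_sum_split i v; rewrite av /= => E; rewrite eq_le class_sum_ge0 andbT.
  have := cosum_ge0 i v; lra.
have : \sum_i phi i v = 0.
  apply: big1 => i _; apply/eqP; rewrite eq_le phi0 andbT.
  by rewrite (le_trans (phi_le_class_sum i v)) // (eqP (psi0 i)).
by have := phi1 v; case: (a v) => //= + E; rewrite E addr0 => /esym/eqP; rewrite oner_eq0.
Qed.

(** If some [psi i] reaches 1, then [a = 1 - psi i] on the multiples of [N]. Otherwise each [psi i]
    has along [e N] a period at most [2 ^ #|I|], and the factorial is a common multiple of all such
    periods. *)
Lemma decomposition_weakly_periodic e :
  (exists i, forall w, a ((w + h i) *~ N) = a (w *~ N)) \/
  (forall w, a ((w + e *~ (2 ^ #|I|)`!%:Z) *~ N) = a (w *~ N)).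
Proof.
have [[i [w1 psi1]]|no1] := pselect (exists i w, 1 <= psi i (w *~ N)); [left|right].
  exists i => w.
  have aE w' : (a (w' *~ N))%:R = 1 - psi i (w' *~ N).
    have := class_sum_split i (w' *~ N).
    rewrite [X in _ + (_ + X)]big1 ?addr0 => [E|j ij].
      by apply/esym/eqP; rewrite subr_eq E.
    exact: phi_eq0_of_class_sum_ge1 psi1 _ _ ij.
  have : (a ((w + h i) *~ N))%:R = (a (w *~ N))%:R :> R.
    by rewrite !aE mulrzDl class_sum_invariant.
  by case: (a _); case: (a _) => //= /eqP; rewrite ?oner_eq0 // eq_sym oner_eq0.
move=> w; rewrite !a_class_sum.
suff psiP i : psi i ((w + e *~ (2 ^ #|I|)`!%:Z) *~ N) = psi i (w *~ N).
  by apply: eq_forallb => i; rewrite psiP.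
pose s l := psi i (w *~ N + (e *~ N) *~ l).
have sE l : s l = psi i ((w + e *~ l) *~ N) by rewrite /s mulrzDl -!mulrzA [N * l]mulrC.
have [b [b1 sb]] : exists b, `|b| < 1 /\ forall l, s l = 0 \/ s l = b.
  have [[l sl]|s0] := pselect (exists l, 0 < s l).
    exists (s l); split.
      rewrite ger0_norm 1?ltW // sE ltNge; apply/negP => s1.
      by apply: no1; exists i; exists (w + e *~ l).
    move=> l'; have := class_sum_ge0 i (w *~ N + (e *~ N) *~ l'); rewrite -/(s l') le_eqVlt.
    move=> /orP[/eqP <-|sl']; [by left|right].
    by move: sl' sl; rewrite !sE; exact: class_sum_const.
  exists 0; split; first by rewrite normr0.
  move=> l; left; apply/eqP; rewrite eq_le class_sum_ge0 andbT leNgt.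
  by apply/negP => sl; apply: s0; exists l.
have [r rI rint] := diff_class_sum_int i e.
have [|P [P0 Pr sP]] := @two_valued_periodic _ r s b b1 sb.
  by move=> l; rewrite /s -iter_diff_line.
have /dvdnP[c cE] : (P %| (2 ^ #|I|)`!)%N.
  by rewrite dvdn_fact // P0 (leq_trans Pr) // leq_exp2l.
have := invariant_mulrz sP c%:Z 0; rewrite !sE add0r mulr0z addr0 => <-.
by congr (psi i ((_ + _ *~ _) *~ _)); rewrite cE; lia.
Qed.

End Decomposition.

(** * Tilings of the plane lattice *)

Definition det2 (u v : Z2) : int := u.1 * v.2 - u.2 * v.1.

Lemma Z2_mulrz (v : Z2) (z : int) : v *~ z = (v.1 * z, v.2 * z).
Proof.
rewrite [LHS]surjective_pairing; congr pair.
  by rewrite (raddfMz fst) mulrzz.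
by rewrite (raddfMz snd) mulrzz.
Qed.

Lemma Z2_mulrz_eq0 (v : Z2) (z : int) : (v *~ z == 0) = (v == 0) || (z == 0).
Proof.
case: v => x y; rewrite Z2_mulrz /= -!pair_eqE /pair_eq /= !mulf_eq0.
by case: (z == 0); rewrite ?orbT ?orbF.
Qed.

Lemma det2_cramer (u v w : Z2) : w *~ det2 u v = u *~ det2 w v + v *~ det2 u w.
Proof. by rewrite !Z2_mulrz /det2; congr pair => /=; ring. Qed.

Lemma det2_mulrz (u v : Z2) (z z' : int) : det2 (u *~ z) (v *~ z') = det2 u v * (z * z').
Proof. by rewrite !Z2_mulrz /det2 /=; ring. Qed.

Definition dot2 (u v : Z2) : int := u.1 * v.1 + u.2 * v.2.

Lemma dot2_eq0 (u : Z2) : (dot2 u u == 0) = (u == 0).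
Proof.
case: u => x y; rewrite /dot2 /= -!expr2 paddr_eq0 ?sqr_ge0 // !sqrf_eq0.
done.
Qed.

(** Projection onto the line of [v] fixes a parallel [u]; here the denominator [dot2 v v] is
    cleared. This turns a multiple of [u] into a multiple of [v]. *)
Lemma det2_parallel (u v : Z2) : det2 u v = 0 -> u *~ dot2 v v = v *~ dot2 u v.
Proof.
rewrite !Z2_mulrz /det2 /dot2 => uv; have {}uv : u.1 * v.2 = u.2 * v.1 by lia.
congr pair.
  by rewrite !mulrDr (mulrCA _ v.2) mulrA uv; ring.
by rewrite !mulrDr (mulrCA _ v.1) (mulrA _ _ v.1) -uv; ring.
Qed.

(** Cramer's rule, with [N] the product of all nonzero determinants. *)
Lemma det2_lattice (I : finType) (d : I -> Z2) :
  exists2 N : int, N != 0 & transversal_lattice (fun i j => det2 (d i) (d j) == 0) d N.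
Proof.
exists (\prod_(p : I * I | det2 (d p.1) (d p.2) != 0) det2 (d p.1) (d p.2)).
  by apply/prodf_neq0.
move=> i j ij w; rewrite (bigD1 (i, j)) //=; set M := \prod_(_ | _) _.
exists (det2 w (d j) * M, det2 (d i) w * M) => /=.
by rewrite !mulrzA det2_cramer mulrzDl.
Qed.

(** Two equal shifts would count every point of [a] twice, so [a] would be empty. *)
Lemma exact_tiling_injective (G : zmodType) (I : finType) (f : I -> G) a :
  exact_tiling f a -> injective f.
Proof.
move=> fa i j fij; apply/eqP; apply/negPn/negP => ij.
have a0 v : a v = false.
  have := fa (v - f i); rewrite (bigD1 i) //= (bigD1 j) 1?eq_sym //= -fij subrK.
  by case: (a v); lia.
by have := fa 0; rewrite big1 // => k _; rewrite a0.
Qed.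

(** [phi i] averages [a] at [v + r d i] over the factors [r] that are 1 modulo the factorial of
    [#|I|]; the next [r] is one translation by the claimed period further. As [d i0 = 0], the term
    of [i0] is always [a v]. *)
Lemma exact_tiling_decomposition (G : zmodType) (R : realType) (I : finType) (i0 : I)
    (f : I -> G) a :
  let d i := f i - f i0 in
  exact_tiling f a ->
  exists phi : I -> G -> R,
    [/\ forall i v, 0 <= phi i v,
        forall i v, phi i (v + d i *~ #|I| `!%:Z) = phi i v &
        forall v, (a v)%:R + \sum_(i | i != i0) phi i v = 1].
Proof.
move=> d fa; have [LIM LIMP] := exists_banach_limit R.
have [LD L0 Lc LS] := LIMP.
pose u v i (m : nat) : R := (a (v + d i *+ (1 + #|I| `! * m)))%:R.
have ub v i : bounded_seq (u v i).
  by exists 1 => m; rewrite /u; case: (a _); rewrite /= ?normr1 ?normr0.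
exists (fun i v => LIM (u v i)); split => [i v|i v|v].
- by apply: L0 => // m; rewrite /u ler0n.
- rewrite -[RHS]LS //; congr LIM; apply/funext => m; rewrite /u /=.
  congr ((a _)%:R); rewrite -pmulrn -addrA -mulrnDr; congr (_ + _ *+ _); lia.
- have da : exact_tiling d a.
    by move=> w; rewrite -[RHS](fa (w - f i0)); apply: eq_bigr => i _; rewrite addrA addrAC.
  rewrite -[RHS]Lc -[X in X + _]Lc -banach_limit_sum // -LD; last 2 first.
  + by exists `|(a v)%:R|.
  + exists #|I|%:R => m; rewrite ger0_norm; last by apply: sumr_ge0 => i _; rewrite ler0n.
    rewrite -natr_sum ler_nat -sum1_card big_mkcond leq_sum // => i _.
    by case: ifP => // _; exact: leq_b1.
  congr LIM; apply/funext => m /=.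
  have cop : coprime (1 + #|I| `! * m) #|I| `!.
    by rewrite coprime_sym mulnC addnC /coprime gcdnMDl gcdn1.
  have := exact_tiling_dilate _ cop da v => /(_ isT).
  rewrite (bigD1 i0) //= /d subrr mul0rn addr0 => /(congr1 (fun k => k%:R : R)).
  by rewrite natrD natr_sum.
Qed.

(** [N] and [U] are chosen before [a], so that finitely many periods serve all orbits at once. *)
Lemma tiling_weakly_periodic (R : realType) (n : nat) (f : 'I_n -> Z2) :
  exists (N : int) (U : seq Z2), [/\ N != 0, {in U, forall u, u != 0} &
    forall a, exact_tiling f a ->
      exists2 u, u \in U & forall w, a ((w + u) *~ N) = a (w *~ N)].
Proof.
have [[a0 fa0]|nofa] := pselect (exists a, exact_tiling f a); last first.
  by exists 1, [::]; split => // a fa; case: nofa; exists a.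
have finj := exact_tiling_injective fa0.
case: n => [|n] in f a0 fa0 finj *; first by have := fa0 0; rewrite big_ord0.
pose I : finType := 'I_n.
pose val := lift (ord0 : 'I_n.+1).
have valP (i : I) : val i != ord0 by [].
pose d i := f i - f ord0.
have d0 i : i != ord0 -> d i != 0 by rewrite subr_eq0 (inj_eq finj).
(* The factorial is the period factor from the averaging; the squared lengths make [h i] a multiple
   of the period of [phi j] for every parallel [j]. *)
pose Q : int := (n.+1`!)%:Z * \prod_(i : I) dot2 (d (val i)) (d (val i)).
pose h (i : I) := d (val i) *~ Q.
have Q0 : Q != 0.
  rewrite mulf_neq0 //; first by rewrite eqz_nat -lt0n fact_gt0.
  by apply/prodf_neq0 => i _; rewrite dot2_eq0 d0 // (valP i).
have h0 i : h i != 0 by rewrite Z2_mulrz_eq0 negb_or Q0 d0 // (valP i).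
have [N N0 latN] := det2_lattice h.
set par := (fun i j => _) in latN.
(* Any nonzero vector would do. *)
pose e : Z2 := (1, 0).
exists N, (e *~ (2 ^ #|I|)`!%:Z :: [seq h i | i <- enum I]); split => //.
  move=> u; rewrite in_cons => /orP[/eqP ->|/mapP[i _ ->]] //.
  by rewrite Z2_mulrz_eq0 /= eqz_nat -lt0n fact_gt0.
move=> a fa; have [phi [phi0 phid phi1]] := exact_tiling_decomposition R ord0 fa.
have dec : invariant_decomposition par h a (fun i : I => phi (val i)).
  split => [i v|i j v ij|v] //; last first.
    by rewrite -[RHS](phi1 v) [in RHS]big_mkcond big_ord_recl /= add0r.
  have {}ij : det2 (d (val i)) (d (val j)) = 0.
    move: ij; rewrite /par /h det2_mulrz mulf_eq0 mulf_eq0 (negbTE Q0) !orbF.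
    by move=> /eqP.
  rewrite /h /Q (bigD1 j) //= [X in _ *~ X]mulrCA mulrzA det2_parallel // -!mulrzA mulrCA mulrzA.
  have := phid (val j); rewrite card_ord => phidj.
  exact: (invariant_mulrz phidj).
have [|[i hi]|he] := @decomposition_weakly_periodic _ R I par h N a _ _ dec latN e.
- by move=> i; rewrite /par /det2 mulrC subrr.
- by exists (h i) => //; rewrite in_cons map_f ?orbT // mem_enum.
- by exists (e *~ (2 ^ #|I|)`!%:Z) => //; rewrite mem_head.
Qed.

(** * Measurable cells *)

Lemma negligible_countable_bigcup d (T : measurableType d) (R : realFieldType)
    (mu : {measure set T -> \bar R}) (U : countType) (F : U -> set T) :
  (forall i, mu.-negligible (F i)) -> mu.-negligible (\bigcup_i F i).
Proof.
move=> nF.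
have -> : \bigcup_i F i = \bigcup_k oapp F set0 (unpickle k).
  apply/seteqP; split => [x [i _ Fx]|x [k _]].
    by exists (pickle i) => //; rewrite pickleK.
  by case: (unpickle k) => [i|] //= Fx; exists i.
apply: negligible_bigcup => k.
by case: (unpickle k) => [i|] /=; [exact: nF|exact: negligible_set0].
Qed.

Lemma countable_bigcap_measurable d (T : measurableType d) (U : countType) (F : U -> set T) :
  (forall i, measurable (F i)) -> measurable (\bigcap_i F i).
Proof.
move=> mF; rewrite -[\bigcap_i _]setCK setC_bigcap; apply: measurableC.
by apply: countable_bigcupT_measurable => // i; exact: measurableC.
Qed.

(** Used to cut by the first set that contains [x]; the index [size Fs] means that none does. *)
Lemma measurable_find d (T : measurableType d) (Fs : seq (set T)) (i : nat) :
  {in Fs, forall F, measurable F} ->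
  measurable [set x | find (fun F : set T => `[< F x >]) Fs = i].
Proof.
elim: Fs i => [|F Fs IHFs] i mF /=.
  case: i => [|i]; first by rewrite (_ : [set _ | _] = setT) //; apply/seteqP; split.
  by rewrite (_ : [set _ | _] = set0) //; apply/seteqP; split.
have mF0 : measurable F by apply: mF; rewrite mem_head.
have mFs : {in Fs, forall F, measurable F}.
  by move=> F' F'Fs; apply: mF; rewrite in_cons F'Fs orbT.
case: i => [|i].
  suff -> : [set x | (if `[< F x >] then 0%N
      else (find (fun F : set T => `[< F x >]) Fs).+1) = 0%N] = F by [].
  by apply/seteqP; split => x /=; case: asboolP.
suff -> : [set x | (if `[< F x >] then 0%N
    else (find (fun F : set T => `[< F x >]) Fs).+1) = i.+1] =
    ~` F `&` [set x | find (fun F : set T => `[< F x >]) Fs = i].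
  by apply: measurableI; [exact: measurableC|exact: IHFs].
apply/seteqP; split => x /=; case: asboolP => //.
- by move=> nF [].
- by move=> Fx [].
- by move=> _ [_ ->].
Qed.

(** * Preimages and null sets under a measure-preserving action *)

Section Action.
Context (R : realType) (d : measure_display) (X : measurableType d).
Context (mu : probability X R) (G : zmodType) (act : G -> X -> X).
Hypothesis act_mp : measure_preserving_action mu act.

(** Measurability and invariance of the measure are assumed for preimages, hence the translation. *)
Lemma act_image (g : G) (E : set X) : act g @` E = act (- g) @^-1` E.
Proof.
have [[act0 actD] _ _] := act_mp.
apply/seteqP; split => [_ [x Ex <-]|x Ex] /=; first by rewrite -actD addNr act0.
by exists (act (- g) x) => //; rewrite -actD subrr act0.
Qed.

Lemma measurable_act_preimage (g : G) (E : set X) : measurable E -> measurable (act g @^-1` E).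
Proof. by have [_ mact _] := act_mp; move=> mE; rewrite -[_ @^-1` _]setTI; exact: mact. Qed.

Lemma negligible_act_preimage (g : G) (E : set X) :
  mu.-negligible E -> mu.-negligible (act g @^-1` E).
Proof.
have [_ _ actmu] := act_mp; move=> [E' [mE' muE' EE']].
exists (act g @^-1` E'); split; first exact: measurable_act_preimage.
  by rewrite actmu.
by move=> x; apply: EE'.
Qed.

End Action.

(** [partition] demands nonempty cells, so the empty ones are dropped and the others renumbered. *)
Lemma partition_nonempty_cells (T : Type) (m : nat) (B : 'I_m -> set T) (A : set T)
    (P : set T -> Prop) :
  (forall i j, B i `&` B j !=set0 -> i = j) -> \bigcup_i B i = A -> (forall i, P (B i)) ->
  exists (m' : nat) (B' : 'I_m' -> set T), partition [set: 'I_m'] B' A /\ forall i, P (B' i).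
Proof.
move=> Bdis BA PB; pose J := [pred i | `[< B i !=set0 >]].
exists #|J|, (fun k => B (enum_val k)); split => //; split.
- rewrite /cover -BA; apply/seteqP; split => [x [k _ Bx]|x [i _ Bx]]; first by exists (enum_val k).
  have Ji : i \in J by apply/asboolP; exists x.
  by exists (enum_rank_in Ji i) => //; rewrite enum_rankK_in.
- by move=> k k' _ _ /Bdis; exact: enum_val_inj.
- by move=> k _; exact/asboolP/(enum_valP k).
Qed.

(** * Cutting the tile by the first period of the return set *)

Theorem theorem1p3 (R : realType) (d : measure_display) (X : measurableType d)
    (mu : probability X R) (act : Z2 -> X -> X)
    (act_mp : measure_preserving_action mu act)
    (act_erg : ergodic_action mu act)
    (A : set X) (mA : measurable A)
    (n : nat) (g : 'I_n -> Z2)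
    (tiling : ae_partition mu (fun i : 'I_n => act (g i) @` A) [set: X]) :
  exists (m : nat) (B : 'I_m -> set X),
    [/\ partition [set: 'I_m] B A,
        forall i, measurable (B i) &
        forall i, exists2 h : Z2, h != 0 & ae_eq_set mu (act h @` B i) (B i)].
Proof.
have [[act0 actD] mact actmu] := act_mp; have [tdis tcov] := tiling.
pose T i := act (g i) @` A.
(* The shifts are [- g i] because [v x] lies in [g i A] exactly when [(v - g i) x] lies in [A]. *)
have [N [U [N0 U0 UP]]] := tiling_weakly_periodic R (fun i => - g i).
pose a x v := `[< A (act v x) >].
(* Points whose orbit meets an overlap of two tiles or the uncovered part. *)
pose bad := \bigcup_v act v @^-1`
  ((\bigcup_(p : 'I_n * 'I_n) (if p.1 == p.2 then set0 else T p.1 `&` T p.2)) `|`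
   ~` \bigcup_i T i).
have nbad : mu.-negligible bad.
  apply: negligible_countable_bigcup => v; apply: negligible_act_preimage act_mp _ _ _.
  apply: negligibleU.
    apply: negligible_countable_bigcup => -[i j] /=.
    by case: eqP => [_|ij]; [exact: negligible_set0|exact: tdis].
  by apply: negligibleS tcov => x nx; right; split.
have good x : ~ bad x -> exact_tiling (fun i => - g i) (a x).
  move=> nb v.
  have [i aT] : exists i, T i (act v x).
    apply: contrapT => nT; apply: nb; exists v => //=; right => -[i _ Ti].
    by apply: nT; exists i.
  have aE j : a x (v - g j) = `[< T j (act v x) >].
    by rewrite /a /T (act_image act_mp) /= -actD [- g j + v]addrC.
  rewrite (bigD1 i) //= aE asboolT // big1 // => j ji.
  rewrite aE asboolF // => Tj; apply: nb; exists v => //=; left.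
  by exists (j, i) => //=; rewrite (negbTE ji).
pose per u := \bigcap_(w : Z2) [set x | a x ((w + u) *~ N) = a x (w *~ N)].
have mper u : measurable (per u).
  apply: countable_bigcap_measurable => w.
  have -> : [set x | a x ((w + u) *~ N) = a x (w *~ N)] =
    (act ((w + u) *~ N) @^-1` A `&` act (w *~ N) @^-1` A) `|`
    (~` (act ((w + u) *~ N) @^-1` A) `&` ~` (act (w *~ N) @^-1` A)).
    apply/seteqP; split => x /=; rewrite /a.
      by case: asboolP; case: asboolP => //; [left|right].
    by move=> [[p q]|[p q]]; [rewrite !asboolT|rewrite !asboolF].
  by apply: measurableU; apply: measurableI; try apply: measurableC;
    exact: measurable_act_preimage act_mp _ _ _.
(* Moving the base point by [z N] only translates [w], which ranges over the whole group. *)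
have per_act u z x : per u (act (z *~ N) x) <-> per u x.
  have H y z' : per u y -> per u (act (z' *~ N) y).
    move=> py w _ /=; rewrite /a -!actD -!mulrzDl addrAC.
    exact: (py (w + z') I).
  split; last exact: H.
  by move=> /(H _ (- z)); rewrite -actD -mulrzDl addNr mul0rz act0.
pose cell x := find (fun F : set X => `[< F x >]) [seq per u | u <- U].
have cell_act z x : cell (act (z *~ N) x) = cell x.
  rewrite /cell; apply: eq_in_find => _ /mapP[u _ ->].
  by apply/asboolP/asboolP => /per_act.
pose B (i : 'I_(size U).+1) := A `&` [set x | cell x = i].
have mB i : measurable (B i).
  by apply: measurableI => //; apply: measurable_find => _ /mapP[u _ ->].
have [||i|m' [B' [B'A B'P]]] := @partition_nonempty_cells X _ B A (fun E => measurable E /\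
    exists2 h : Z2, h != 0 & ae_eq_set mu (act h @` E) E).
- by move=> i j [x [[_ /= xi] [_ /= xj]]]; apply: val_inj; rewrite /= -xi -xj.
- apply/seteqP; split => [x [i _ []]//|x Ax].
  have cx : (cell x < (size U).+1)%N by rewrite ltnS /cell (leq_trans (find_size _ _)) ?size_map.
  by exists (Ordinal cx).
- split=> //; have [iU|Ui] := ltnP i (size U).
    pose u := nth 0 U i; exists (u *~ N).
      by rewrite Z2_mulrz_eq0 negb_or N0 U0 // mem_nth.
    have peru x : cell x = i -> per u x.
      move=> xi; have : has (fun F : set X => `[< F x >]) [seq per u | u <- U].
        by rewrite has_find size_map -/(cell x) xi.
      by move=> /(nth_find set0); rewrite -/(cell x) xi (nth_map 0) // => /asboolP.
    suff -> : act (u *~ N) @` B i = B i by rewrite /ae_eq_set setYK; exact: negligible_set0.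
    (* The period relation at [w = - u] puts [x] and its translate by [- u N] in [A] together; both
       have the same cell index by [cell_act]. *)
    rewrite (act_image act_mp) -mulNrz; apply/seteqP; split => x [] /= Ax xi.
      have cx : cell x = i by rewrite -xi cell_act.
      split=> //; have := peru _ cx (- u) I.
      rewrite /= /a addNr mul0rz act0 => E; apply/asboolP; rewrite E; exact/asboolP.
    split; last by rewrite /= cell_act.
    have := peru _ xi (- u) I.
    by rewrite /= /a addNr mul0rz act0 (asboolT Ax) => /esym/asboolP.
  (* The last cell collects the points with no period in [U]; these are bad, so any nonzero vector
     preserves it up to null sets. *)
  have nB : mu.-negligible (B i).
    apply: negligibleS nbad => x [_ /= xi]; apply: contrapT => /good/UP[u uU pu].
    have : has (fun F : set X => `[< F x >]) [seq per u | u <- U].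
      apply/hasP; exists (per u); first exact: map_f.
      by apply/asboolP => w _; exact: pu.
    by rewrite has_find size_map -/(cell x) xi ltnNge Ui.
  exists (1, 0) => //; apply: negligibleU; apply: negligibleS (@subDsetl _ _ _) _ => //.
  by rewrite (act_image act_mp); exact: negligible_act_preimage act_mp _ _ nB.
by exists m', B'; split => // i; have [] := B'P i.
Qed.
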